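(* Let $G$ be a finite simple cubic graph. Suppose that at least one of the following holds: (1) $G$ contains a subgraph $T$ which is a cubic tree such that the graph $G - E(T)$ is bipartite; (2) $G$ can be decomposed into a tree and a cycle. Then $G$ has an external split $(X,Y)$ with $-2 \le |X| - |Y| \le 2$.
   Context: A split of a graph $G=(V,E)$ is a pair $(X,Y)$ of disjoint sets with $X \sqcup Y = V$. Write $E(X,Y)$ for the set of edges with one end in $X$ and the other in $Y$. A split $(X,Y)$ is external if the graph $H = G - E(X,Y)$ satisfies $\deg_H(v) \le \frac12 \deg_G(v)$ for every $v \in V(G)$. A tree is called cubic if each of its vertices has degree $1$ or $3$ (in the tree). $G$ can be decomposed into a tree and a cycle if there exist a tree $T$ and a cycle $C$ (subgraphs of $G$) such that $\{E(T),E(C)\}$ is a partition of $E(G)$. *)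

(* Defs.v *)
From HB Require Import structures.
From mathcomp Require Import all_boot all_order all_algebra.

Set Implicit Arguments.
Unset Strict Implicit.
Unset Printing Implicit Defensive.

Import Order.TTheory GRing.Theory Num.Theory.

Section Graphs.

Variable V : finType.

(* A finite simple graph whose vertex set is a subset of an ambient finite type,
   so that a graph and its subgraphs have the same type. *)
Record graph := Graph {
  verts : {set V};
  edges : {set {set V}};
  edges_wf : [forall e in edges, (e \subset verts) && (#|e| == 2)]
}.

Implicit Types (G H T C : graph) (X Y : {set V}) (x y v : V).

Definition adj G : rel V := fun x y => [set x; y] \in edges G.

Definition degree G v : nat := #|[set e in edges G | v \in e]|.

Definition subgraph H G : Prop :=
  verts H \subset verts G /\ edges H \subset edges G.

Lemma del_edges_wf G (F : {set {set V}}) :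
  [forall e in edges G :\: F, (e \subset verts G) && (#|e| == 2)].
Proof.
apply/forall_inP => e /setDP [eG _].
exact: (forall_inP (edges_wf G) e eG).
Qed.

Definition del_edges G (F : {set {set V}}) : graph := Graph (del_edges_wf G F).

Definition cubic G : Prop := forall v, v \in verts G -> degree G v = 3.

Definition is_cycle C : Prop :=
  exists c : seq V, [/\ 3 <= size c, uniq c,
    verts C = [set x in c] &
    edges C = [set [set x; next c x] | x in c]].

Definition is_connected G : Prop :=
  verts G != set0 /\ {in verts G &, forall x y, connect (adj G) x y}.

Definition acyclic G : Prop := forall C, subgraph C G -> ~ is_cycle C.

Definition is_tree T : Prop := is_connected T /\ acyclic T.

Definition is_cubic_tree T : Prop :=
  is_tree T /\ (forall v, v \in verts T -> degree T v = 1 \/ degree T v = 3).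

Definition is_split G X Y : Prop :=
  [disjoint X & Y] /\ X :|: Y = verts G.

Definition edges_between G X Y : {set {set V}} :=
  [set e in edges G | [exists x in X, exists y in Y, e == [set x; y]]].

Definition bipartite G : Prop :=
  exists X Y, is_split G X Y /\ edges G \subset edges_between G X Y.

Definition external_split G X Y : Prop :=
  is_split G X Y /\
  (forall v, v \in verts G ->
     ((degree (del_edges G (edges_between G X Y)) v)%:R
        <= 2%:R^-1 * (degree G v)%:R :> rat)%R).

Definition tree_cycle_decomposable G : Prop :=
  exists T C,
    [/\ is_tree T, is_cycle C, subgraph T G & subgraph C G] /\
    [/\ edges T != set0, edges C != set0,
        [disjoint edges T & edges C] & edges T :|: edges C = edges G].

End Graphs.

(* Main.v *)
Require Import Defs.
From HB Require Import structures.
From mathcomp Require Import all_boot all_order all_algebra.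
From mathcomp Require Import zify.

Set Implicit Arguments.
Unset Strict Implicit.
Unset Printing Implicit Defensive.

Import Order.TTheory GRing.Theory Num.Theory.

(** Colour the vertices with two colours; the split into colour classes is
    external iff every vertex has at most one neighbour of its own colour.
    Counting edge ends in a cubic graph gives 3(|X| - |Y|) = 2z, where z is the
    number of monochromatic edges inside X minus the number inside Y, so it
    suffices to find such a colouring with |z| <= 5: then 3 | z forces |z| <= 3.

    If G - E(T) is bipartite, its 2-colouring prescribes the colours of the
    leaves of T, the inner vertices of T are isolated in G - E(T), and only edges
    of T can be monochromatic.  Plant T at a leaf.  For every branch record which
    z it can contribute, depending on the colour of its root and on whether the
    edge above the root is monochromatic.  Up to discarding |z| > 5 and entries
    that are not needed, only 12 such tables occur, and each of them contains a
    small z.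

    If E(G) splits into T and a cycle C, then T is a cubic tree with leaf set
    V(C), and an even C is the previous case.  If C is odd, the bipartition of T
    is not proper on C, so some edge uv of C joins vertices at even distance in T.
    Colour u and v alike and alternate along the rest of C.  Now the tree edges at
    u and v must not be monochromatic; planting T at u and keeping track of the
    parity of the distance to v again leads to finitely many tables (23 for
    either parity), all of which contain a small z. *)

(** * Finite tables of branch contributions *)

Definition sgn (b : bool) : int := if b then 1%R else (-1)%R.

(* [entry A b m] lists values z contributed by a branch, including the edge above
   its root, when the root has colour [b] and that edge is monochromatic iff
   [m]; thus the parent of the root has colour [b == m]. *)
Definition table := (seq int * seq int * seq int * seq int)%type.

Definition entry (A : table) (b m : bool) : seq int :=
  let: (n1, n0, m1, m0) := A in
  if m then (if b then m1 else m0) else (if b then n1 else n0).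

Definition mk_table (f : bool -> bool -> seq int) : table :=
  (f true false, f false false, f true true, f false true).

Lemma entry_mk_table f b m : entry (mk_table f) b m = f b m.
Proof. by case: b m => [] []. Qed.

Definition sumset (s t : seq int) : seq int := [seq (x + y)%R | x <- s, y <- t].

(* An inner vertex has at most one monochromatic edge among the one above it and
   the two below it. *)
Definition combine (A B : table) : table :=
  mk_table (fun b m =>
    let n := sumset (entry A (~~ b) false) (entry B (~~ b) false) in
    undup [seq z <- (if m then [seq (sgn b + z)%R | z <- n] else
        n ++ sumset (entry A b true) (entry B (~~ b) false)
          ++ sumset (entry A (~~ b) false) (entry B b true))
      | absz z <= 5]).

(** An entry only promises that a suitable colouring exists, so a branch realizing a table realizes
    every smaller one. Hence it is sound to discard entries and to keep only inclusion-minimal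
    tables. *)
Definition subtable (A B : table) : bool :=
  all (fun bm => all (mem (entry B bm.1 bm.2)) (entry A bm.1 bm.2))
    [:: (true, false); (false, false); (true, true); (false, true)].

Lemma subtableP A B b m : subtable A B -> {subset entry A b m <= entry B b m}.
Proof.
move=> /allP sAB z zA.
have bmin : (b, m) \in [:: (true, false); (false, false); (true, true); (false, true)].
  by case: b m {zA} => [] [].
exact: (allP (sAB _ bmin)).
Qed.

Definition leaf_table (b : bool) : table :=
  mk_table (fun b' m => if b' != b then [::] else if m then [:: sgn b] else [:: 0%R]).

(** The leaf [v] already has its monochromatic edge on the odd cycle, so its tree edge must be
    bichromatic; its colour is normalized to [true]. *)
Definition marked_leaf_table : table :=
  mk_table (fun b m => if b && ~~ m then [:: 0%R] else [::]).

Definition covered (Q : seq table) (A : table) : bool := has (subtable^~ A) Q.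

(* Keeps only the inclusion-minimal tables. *)
Definition insert_table (A : table) (Q : seq table) : seq table :=
  if covered Q A then Q else A :: [seq B <- Q | ~~ subtable A B].

(* The numbers of iterations, here and in [marked_tables], were found by
   experiment; the lemmas below check that they suffice. *)
Definition tables : seq table :=
  iter 6 (fun Q => foldr insert_table Q [seq combine A B | A <- Q, B <- Q])
    [:: leaf_table true; leaf_table false].

Definition grow (Q Q' : seq table) : seq table :=
  foldr insert_table Q' [seq combine A B | A <- Q, B <- tables].

(* Tables of the branches containing v, split by the parity of the distance from
   the root to v: even in the first component. *)
Definition marked_tables : seq table * seq table :=
  iter 10 (fun Q => (grow Q.2 Q.1, grow Q.1 Q.2)) ([:: marked_leaf_table], [::]).

Lemma tables_leaf b : covered tables (leaf_table b).
Proof. by case: b; vm_compute. Qed.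

Lemma tables_combine A B :
  A \in tables -> B \in tables -> covered tables (combine A B).
Proof.
have cl : all (fun A => all (fun B => covered tables (combine A B)) tables) tables.
  by vm_compute.
move=> AQ BQ; exact: (allP (allP cl A AQ) B BQ).
Qed.

(** Here [b] is the prescribed colour of the leaf at which the tree is planted. The edge below it
    may be monochromatic or not, and [b == m] is the resulting colour of the root of the branch. *)
Lemma tables_final A b :
  A \in tables -> exists m z, z \in entry A (b == m) m /\ absz z <= 5.
Proof.
have fin : all (fun A => all (fun b => has (fun m => has (fun z => absz z <= 5)
    (entry A (b == m) m)) [:: true; false]) [:: true; false]) tables.
  by vm_compute.
have bin : b \in [:: true; false] by clear; case: b.
move=> AQ; have /hasP[m _ /hasP[z zA z5]] := allP (allP fin A AQ) b bin.
exact: (ex_intro _ m (ex_intro _ z (conj zA z5))).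
Qed.

Definition marked_tables_at (odd_depth : bool) : seq table :=
  if odd_depth then marked_tables.2 else marked_tables.1.

Lemma marked_tables_leaf : covered (marked_tables_at false) marked_leaf_table.
Proof. by vm_compute. Qed.

Lemma marked_tables_combine o A B :
  A \in marked_tables_at o -> B \in tables ->
  covered (marked_tables_at (~~ o)) (combine A B)
  && covered (marked_tables_at (~~ o)) (combine B A).
Proof.
have cl : all (fun o => all (fun A => all (fun B =>
    covered (marked_tables_at (~~ o)) (combine A B)
    && covered (marked_tables_at (~~ o)) (combine B A)) tables)
    (marked_tables_at o)) [:: true; false] by vm_compute.
have oin : o \in [:: true; false] by clear; case: o.
move=> AQ BQ; exact: (allP (allP (allP cl o oin) A AQ) B BQ).
Qed.

(** The tree is planted at [u], of colour [true], with a bichromatic edge below, so the root has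
    colour [false]; it is at odd distance from [v] because [u] is at even distance. The summand 1 is
    the contribution of the edge [uv] of the cycle. *)
Lemma marked_tables_final A :
  A \in marked_tables_at true ->
  exists2 z, z \in entry A false false & absz (z + 1)%R <= 5.
Proof.
have fin : all (fun A => has (fun z => absz (z + 1)%R <= 5) (entry A false false))
    (marked_tables_at true) by vm_compute.
move=> AQ; exact: (hasP (allP fin A AQ)).
Qed.

(* Otherwise [done] tries to evaluate these lists. *)
Opaque tables marked_tables_at.

(** Of the three edge ends at a node, one completes each branch below and one belongs to the edge
    above, whose two ends add up to [2 * sgn b] if it is monochromatic and to 0 otherwise. *)
Lemma node_weight (b m : bool) (wl wr zl zr : int) :
  (wl + sgn b = 2 * zl -> wr + sgn b = 2 * zr ->
   3 * sgn b + wl + wr + sgn (b == m)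
   = 2 * ((if m then sgn b else 0) + zl + zr))%R.
Proof. by case: b m => [] [] /=; rewrite /sgn; lia. Qed.

(** * Colourings of planted binary trees *)

Section PlantedTrees.

Variable V : eqType.

Inductive ptree := Leaf of V | Node of V & ptree & ptree.

Implicit Types (t l r : ptree) (c lam : V -> bool) (R : pred V) (A B : table).

Definition troot t := match t with Leaf x => x | Node x _ _ => x end.

Fixpoint tverts t : seq V :=
  match t with Leaf x => [:: x] | Node x l r => x :: tverts l ++ tverts r end.

Fixpoint inner t : seq V :=
  match t with Leaf x => [::] | Node x l r => x :: inner l ++ inner r end.

(** The argument [p] is the colour of the vertex above the root. A leaf has a single tree edge, so
    only membership in [R] constrains it. *)
Fixpoint valid R c (p : bool) t : bool :=
  match t with
  | Leaf x => R x ==> (c x != p)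
  | Node x l r =>
      [&& (c x == p) + (c x == c (troot l)) + (c x == c (troot r)) <= 1,
          valid R c (c x) l & valid R c (c x) r]
  end.

(** The coefficients 1 and 3 are degrees in the tree, the edge to the parent included, so this is a
    signed count of edge ends. *)
Fixpoint weight c t : int :=
  match t with
  | Leaf x => sgn (c x)
  | Node x l r => (3 * sgn (c x) + weight c l + weight c r)%R
  end.

Lemma root_tverts t : troot t \in tverts t.
Proof. by case: t => [x|x l r] /=; rewrite inE eqxx. Qed.

Lemma inner_tverts t : {subset inner t <= tverts t}.
Proof.
elim: t => [x|x l IHl r IHr] y //=; rewrite !inE !mem_cat.
by case/orP => [-> //|/orP[/IHl|/IHr] ->]; rewrite !orbT.
Qed.

Lemma eq_valid R c c' p t :
  {in tverts t, c =1 c'} -> valid R c p t = valid R c' p t.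
Proof.
elim: t p => [x|x l IHl r IHr] p /= e; first by rewrite e ?inE.
have el : {in tverts l, c =1 c'} by move=> y yl; apply: e; rewrite inE mem_cat yl orbT.
have er : {in tverts r, c =1 c'} by move=> y yr; apply: e; rewrite inE mem_cat yr !orbT.
rewrite IHl // IHr // (e x) ?inE ?eqxx //.
by rewrite (el _ (root_tverts l)) (er _ (root_tverts r)).
Qed.

Lemma eq_weight c c' t : {in tverts t, c =1 c'} -> weight c t = weight c' t.
Proof.
elim: t => [x|x l IHl r IHr] /= e; first by rewrite e ?inE.
rewrite (e x) ?inE ?eqxx // IHl ?IHr // => y yt; apply: e.
  by rewrite inE mem_cat yt !orbT.
by rewrite inE mem_cat yt orbT.
Qed.

(* [lam] prescribes the colours of the vertices that are not inner, and [R] is the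
   set of leaves whose tree edge must not be monochromatic. *)
Definition realizable R lam t A : Prop :=
  forall b m z, z \in entry A b m ->
    exists c, [/\ forall v, v \notin inner t -> c v = lam v, c (troot t) = b,
      valid R c (b == m) t & (weight c t + sgn (b == m) = 2 * z)%R].

Lemma realizable_sub R lam t A B :
  subtable A B -> realizable R lam t B -> realizable R lam t A.
Proof. by move=> sAB rB b m z /(subtableP sAB); apply: rB. Qed.

Lemma realizable_leaf R lam x :
  ~~ R x -> realizable R lam (Leaf x) (leaf_table (lam x)).
Proof.
move=> Rx b m z; rewrite entry_mk_table; case: eqP => //= -> zm.
exists lam; split => //=; first by rewrite (negPf Rx).
by move: zm; case: m; rewrite inE => /eqP ->; case: (lam x).
Qed.

Lemma realizable_marked_leaf R lam x :
  lam x -> realizable R lam (Leaf x) marked_leaf_table.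
Proof.
move=> lx b m z; rewrite entry_mk_table; case: b m => [] [] //=.
rewrite inE => /eqP ->; exists lam; split => //=; first by rewrite lx implybT.
by rewrite lx.
Qed.

(** The colourings of the two branches live on disjoint vertex sets, so they can be glued at [x]
    once both presuppose the same colour there and at most one of the three edges at [x] is
    monochromatic. *)
Lemma realizable_node R lam x l r A B :
  uniq (tverts (Node x l r)) -> realizable R lam l A -> realizable R lam r B ->
  realizable R lam (Node x l r) (combine A B).
Proof.
rewrite /= mem_cat cat_uniq negb_or => /andP[/andP[xl xr]] /and3P[_ dlr _].
move=> rA rB b m z.
(* The term [b == (b == m)] is just [m], in the shape in which [valid] produces it. *)
have glue bl ml br mr zl zr :
    zl \in entry A bl ml -> zr \in entry B br mr ->
    (bl == ml) = b -> (br == mr) = b -> (b == (b == m)) + ml + mr <= 1 ->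
    z = ((if m then sgn b else 0) + zl + zr)%R ->
    exists c, [/\ forall v, v \notin inner (Node x l r) -> c v = lam v,
      c (troot (Node x l r)) = b, valid R c (b == m) (Node x l r)
      & (weight c (Node x l r) + sgn (b == m) = 2 * z)%R].
  move=> /rA[cl [cl1 cl2 cl3 cl4]] /rB[cr [cr1 cr2 cr3 cr4]] ebl ebr le1 ->.
  pose c v := if v == x then b else if v \in tverts l then cl v else cr v.
  have cx : c x = b by rewrite /c eqxx.
  have cE : {in tverts l, c =1 cl}.
    by move=> v vl; rewrite /c vl; case: eqP => // vx; rewrite -vx vl in xl.
  have cF : {in tverts r, c =1 cr}.
    move=> v vr; rewrite /c; case: eqP => [vx|_]; first by rewrite -vx vr in xr.
    by case: ifP => // vl; case/hasP: dlr; exists v.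
  exists c; split => //=.
  - move=> v; rewrite inE mem_cat !negb_or /c => /and3P[/negPf -> vl vr].
    by case: ifP => _; [apply: cl1 | apply: cr1].
  - rewrite cx (cE _ (root_tverts l)) (cF _ (root_tverts r)) cl2 cr2.
    move: cl3 cr3; rewrite ebl ebr (eq_valid _ _ cE) (eq_valid _ _ cF) => -> ->.
    by case: (b) (m) (bl) (ml) (br) (mr) ebl ebr le1 => [] [] [] [] [] [].
  - rewrite cx (eq_weight cE) (eq_weight cF); move: cl4 cr4; rewrite ebl ebr.
    exact: node_weight.
rewrite entry_mk_table mem_undup mem_filter => /andP[_].
case: m glue => glue.
  case/mapP => w /allpairsP[[zl zr] /= [zlA zrB ->]] ez.
  by apply: (glue _ _ _ _ _ _ zlA zrB); rewrite ?ez ?addrA //; case: (b).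
rewrite !mem_cat => /or3P[] /allpairsP[[zl zr] /= [zlA zrB ez]];
  by apply: (glue _ _ _ _ _ _ zlA zrB); rewrite ?ez ?add0r //; case: (b).
Qed.

Lemma uniq_node x l r :
  uniq (tverts (Node x l r)) -> uniq (tverts l) /\ uniq (tverts r).
Proof. by rewrite /= cat_uniq => /andP[_ /and3P[]]. Qed.

Lemma realizable_covered R lam t Q A :
  covered Q A -> realizable R lam t A -> exists2 B, B \in Q & realizable R lam t B.
Proof. by case/hasP => B BQ sBA rA; exists B => //; apply: realizable_sub rA. Qed.

Lemma realizable_tables R lam t :
  uniq (tverts t) -> {in tverts t, forall x, ~~ R x} ->
  exists2 A, A \in tables & realizable R lam t A.
Proof.
elim: t => [x|x l IHl r IHr] Ut Rt.
  apply: (realizable_covered (tables_leaf (lam x))).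
  by apply: realizable_leaf; apply: Rt; rewrite inE.
have [Ul Ur] := uniq_node Ut.
have [y yl|A AQ rA] := IHl Ul; first by apply: Rt; rewrite /= inE mem_cat yl orbT.
have [y yr|B BQ rB] := IHr Ur; first by apply: Rt; rewrite /= inE mem_cat yr !orbT.
exact: realizable_covered (tables_combine AQ BQ) (realizable_node Ut rA rB).
Qed.

Fixpoint alternating (d : V -> bool) t : bool :=
  match t with
  | Leaf x => true
  | Node x l r => [&& d (troot l) != d x, d (troot r) != d x,
                      alternating d l & alternating d r]
  end.

(** Only one of the two branches at a node contains [v]; the other is covered by
    [realizable_tables]. Passing to the parent flips the parity of the distance to [v], which is
    read off from the alternating colouring [d]. *)
Lemma realizable_marked_tables lam v d t :
  lam v -> uniq (tverts t) -> v \in tverts t -> v \notin inner t ->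
  alternating d t ->
  exists2 A, A \in marked_tables_at (d v != d (troot t))
    & realizable (pred1 v) lam t A.
Proof.
move=> lv; elim: t => [x|x l IHl r IHr] Ut.
  rewrite inE => /eqP <- _ _; rewrite eqxx.
  exact: realizable_covered marked_tables_leaf (realizable_marked_leaf _ lv).
have [Ul Ur] := uniq_node Ut.
have dlr : ~~ has (mem (tverts l)) (tverts r).
  by move: Ut; rewrite /= cat_uniq => /andP[_ /and3P[]].
rewrite /= !inE !mem_cat !negb_or => vt /and3P[vx vl vr] /and4P[dl dr al ar].
have neg a b : a != b -> (d v != b) = ~~ (d v != a) by case: (d v) a b => [] [] [].
have other t' : v \notin tverts t' -> {in tverts t', forall x, ~~ pred1 v x}.
  by move=> vt' y yt' /=; apply: contraNneq vt' => <-.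
rewrite (negPf vx) /= in vt; case/orP: vt => vt.
  have [A AQ rA] := IHl Ul vt vl al.
  have vr' : v \notin tverts r by apply: contra dlr => vr'; apply/hasP; exists v.
  have [B BQ rB] := realizable_tables lam Ur (other _ vr').
  rewrite (neg _ _ dl); have /andP[cAB _] := marked_tables_combine AQ BQ.
  exact: realizable_covered cAB (realizable_node Ut rA rB).
have [A AQ rA] := IHr Ur vt vr ar.
have vl' : v \notin tverts l by apply: contra dlr => vl'; apply/hasP; exists v.
have [B BQ rB] := realizable_tables lam Ul (other _ vl').
rewrite (neg _ _ dr); have /andP[_ cBA] := marked_tables_combine AQ BQ.
exact: realizable_covered cBA (realizable_node Ut rB rA).
Qed.

End PlantedTrees.

(** * Adjacency, degrees and edge-end counting *)

Section GraphBasics.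

Variable V : finType.

Implicit Types (G T : graph V) (x y z v : V).

Lemma adj_sym G x y : adj G x y = adj G y x.
Proof. by rewrite /adj setUC. Qed.

Lemma adj_neq G x y : adj G x y -> x != y.
Proof.
move=> xy; have /andP[_] := forall_inP (edges_wf G) _ xy.
by rewrite cards2; case: (x != y).
Qed.

Lemma adj_verts G x y : adj G x y -> (x \in verts G) && (y \in verts G).
Proof.
move=> xy; have /andP[/subsetP s _] := forall_inP (edges_wf G) _ xy.
by rewrite !s // !inE eqxx ?orbT.
Qed.

Lemma edge_at G e v : e \in edges G -> v \in e -> exists2 x, e = [set v; x] & adj G v x.
Proof.
move=> eG ve; have /andP[_ /cards2P[x [y [xy de]]]] := forall_inP (edges_wf G) _ eG.
have : (v == x) || (v == y) by move: ve; rewrite de !inE.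
case/orP => /eqP dv; rewrite dv; first by exists y; rewrite // /adj -de.
by exists x; rewrite 1?setUC // /adj setUC -de.
Qed.

Lemma set2_inj v : injective (fun x => [set v; x]).
Proof.
move=> x y exy.
have : x \in [set v; y] by rewrite -exy !inE eqxx orbT.
have : y \in [set v; x] by rewrite exy !inE eqxx orbT.
by rewrite !inE => /orP[/eqP ->|/eqP -> //] /orP[/eqP ->|/eqP ->].
Qed.

Lemma degree_adj G v : degree G v = #|[set x | adj G v x]|.
Proof.
rewrite /degree -(card_imset [set x | adj G v x] (@set2_inj v)); congr #|pred_of_set _|.
apply/setP => e; rewrite inE; apply/andP/imsetP => [[eG ve]|[x]].
  by have [x -> vx] := edge_at eG ve; exists x; rewrite ?inE.
by rewrite inE => vx ->; rewrite !inE eqxx.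
Qed.

Lemma degree_notin G v : v \notin verts G -> degree G v = 0.
Proof.
move=> vG; rewrite degree_adj; apply/eqP; rewrite cards_eq0; apply/eqP/setP => x.
by rewrite !inE; apply: contraNF vG => /adj_verts/andP[].
Qed.

Lemma degree_seq G v s : uniq s -> (forall x, adj G v x = (x \in s)) -> degree G v = size s.
Proof.
move=> Us e; rewrite degree_adj -(card_uniqP Us).
by apply: eq_card => x; rewrite inE e.
Qed.

Lemma degree1_adj G v : degree G v = 1 -> exists w, forall x, adj G v x = (x \in [:: w]).
Proof.
rewrite degree_adj => /eqP/cards1P[w e]; exists w => x.
by have := congr1 (fun A : {set V} => x \in A) e; rewrite !inE.
Qed.

Lemma degree3_adj G v p : degree G v = 3 -> adj G v p ->
  exists x y, uniq [:: p; x; y] /\ forall z, adj G v z = (z \in [:: p; x; y]).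
Proof.
rewrite degree_adj => d3 vp.
have : #|[set x | adj G v x] :\ p| == 2.
  by move: d3; rewrite (cardsD1 p) inE vp => /eqP.
case/cards2P => x [y [xy e]]; exists x, y.
have e' z : (z != p) && adj G v z = (z == x) || (z == y).
  by have := congr1 (fun A : {set V} => z \in A) e; rewrite !inE.
split=> [|z].
  have := e' p; rewrite eqxx /= !inE andbT xy andbT => /esym/negbT.
  by rewrite negb_or.
by rewrite !inE -e'; case: eqVneq => [->|].
Qed.

Lemma degreeD G T v : subgraph T G ->
  degree G v = degree T v + degree (del_edges G (edges T)) v.
Proof.
case=> _ /subsetP sTG; rewrite /degree -cardsUI.
have -> : [set e in edges T | v \in e]
    :&: [set e in edges (del_edges G (edges T)) | v \in e] = set0.
  by apply/setP => e; rewrite !inE /=; case: (e \in edges T); rewrite ?andbF.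
rewrite cards0 addn0; apply: eq_card => e; rewrite !inE /=.
by have := sTG e; case: (e \in edges T) => //= -> //; rewrite orbF.
Qed.

Lemma adjD G T x y : subgraph T G ->
  adj G x y = adj T x y || adj (del_edges G (edges T)) x y.
Proof.
case=> _ /subsetP sTG; rewrite /adj !inE /=.
by have := sTG [set x; y]; case: (_ \in edges T) => //= -> //.
Qed.

Lemma handshake G (f : V -> int) :
  (\sum_v (degree G v)%:R * f v = \sum_(e in edges G) \sum_(v in e) f v)%R.
Proof.
rewrite (exchange_big_dep xpredT) //=; apply: eq_bigr => v _.
rewrite (eq_bigl (mem [set e in edges G | v \in e])) => [|e]; last by rewrite !inE.
by rewrite sumr_const mulr_natl.
Qed.

End GraphBasics.

(** * Unfolding a tree with degrees 1 and 3 into a planted tree *)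

Section TreeUnfolding.

Variables (V : finType) (T : graph V).

Implicit Types (t : ptree V) (D : {set V}) (c d : V -> bool).

(* [t] is the part of the tree [T] hanging below [p]. *)
Fixpoint unfolds (p : V) t : Prop :=
  match t with
  | Leaf x => forall z, adj T x z = (z \in [:: p])
  | Node x l r => [/\ forall z, adj T x z = (z \in [:: p; troot l; troot r]),
                      unfolds x l & unfolds x r]
  end.

Definition adj_in D : rel V := [rel x y | [&& x \in D, y \in D & adj T x y]].

(** For [x] in [D] this is the component of [x] in the subgraph of [T] induced by [D]. *)
Definition branch D x : {set V} := [set z | connect (adj_in D) x z].

Lemma adj_in_sym D : symmetric (adj_in D).
Proof. by move=> x y; rewrite /adj_in /= adj_sym; case: (x \in D); case: (y \in D). Qed.

Lemma branch_sub D x : x \in D -> branch D x \subset D.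
Proof.
move=> xD; apply/subsetP => z; rewrite inE => /connectP[q].
by elim: q x xD => [|y q IH] x xD /= => [_ -> //|/andP[/and3P[_ yD _] /IH]]; apply.
Qed.

Lemma branch_self D x : x \in branch D x.
Proof. by rewrite inE connect0. Qed.

Lemma branch_sym D x y : (y \in branch D x) = (x \in branch D y).
Proof. by rewrite !inE (sym_connect_sym (adj_in_sym D)). Qed.

Lemma branch_trans D x y z : y \in branch D x -> z \in branch D y -> z \in branch D x.
Proof. by rewrite !inE; apply: connect_trans. Qed.

Lemma branch_adj D x y z :
  y \in branch D x -> y \in D -> z \in D -> adj T y z -> z \in branch D x.
Proof.
move=> yB yD zD yz; apply: branch_trans yB _; rewrite inE connect1 //.
by rewrite /adj_in /= yD zD.
Qed.

Lemma branch_mono D D' x : D \subset D' -> branch D x \subset branch D' x.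
Proof.
move=> /subsetP sD; apply/subsetP => z; rewrite !inE.
apply: connect_sub => a b /and3P[aD bD ab]; apply: connect1.
by rewrite /adj_in /= !sD.
Qed.

(** On a path from [r] without repeated vertices, everything after the first step avoids [r]. *)
Lemma branch_step D r z : z \in branch D r -> z != r ->
  exists x, [/\ adj T r x, x \in D :\ r & z \in branch (D :\ r) x].
Proof.
rewrite inE => /connectP[q0 /shortenP[q rq Uq _] ->].
case: q rq Uq => [|x q] /=; first by rewrite eqxx.
case/andP=> /and3P[rD xD rx] xq /andP[]; rewrite inE negb_or => /andP[nrx nrq] _ _.
have xDr : x \in D :\ r by rewrite !inE eq_sym nrx.
exists x; split => //; rewrite inE; apply/connectP; exists q => //.
elim: q x xq xDr nrq {rx nrx xD} => //= y q IH x /andP[/and3P[xD yD xy] yq] xDr.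
rewrite inE negb_or => /andP[ry rq].
have yDr : y \in D :\ r by rewrite !inE eq_sym ry.
rewrite {1}/adj_in /= xDr yDr xy /=; exact: IH.
Qed.

Hypothesis acyT : acyclic T.

Lemma no_cycle s : 3 <= size s -> uniq s -> ~ cycle (adj T) s.
Proof.
move=> s3 Us cs.
have wf : [forall e in [set [set x; next s x] | x in s],
    (e \subset [set x in s]) && (#|e| == 2)].
  apply/forall_inP => e /imsetP[x xs ->]; rewrite cards2 (adj_neq (next_cycle cs xs)).
  by rewrite andbT; apply/subsetP => y; rewrite !inE => /orP[/eqP ->|/eqP ->];
     rewrite ?mem_next.
apply: (acyT (C := Graph wf)); last by exists s.
split => /=.
  apply/subsetP => x; rewrite inE => xs.
  by have /andP[] := adj_verts (next_cycle cs xs).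
by apply/subsetP => e /imsetP[x xs ->]; apply: next_cycle cs xs.
Qed.

(** A path between two distinct neighbours of [r] inside [D] would close up to a cycle through
    [r]. *)
Lemma branch_neighbour_unique D r x y : r \notin D -> x \in D ->
  adj T r x -> adj T r y -> y \in branch D x -> x = y.
Proof.
move=> rD xD rx ry; rewrite inE => /connectP[q0 /shortenP[q xq Uq _] dy].
case: (posnP (size q)) => [/size0nil q0nil|q_gt0]; first by rewrite dy q0nil.
have qD : {subset x :: q <= D}.
  move: xD xq {Uq dy q_gt0 rx}; elim: q x => [|a q IH] x xD /=.
    by move=> _ z; rewrite inE => /eqP ->.
  case/andP => /and3P[_ aD _] /(IH _ aD) IHq z; rewrite inE => /predU1P[-> //|].
  exact: IHq.
case: (@no_cycle (r :: x :: q)) => //.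
  by rewrite cons_uniq Uq andbT; apply: contra rD => /qD.
rewrite /= rx rcons_path -dy adj_sym ry andbT.
by apply: sub_path xq => a b /and3P[].
Qed.

(** Induction on the size of [D]: delete [r] and recurse into the branches of its other neighbours.
    The last hypothesis says that only the edge [rp] leaves the branch; it keeps the children inside
    [D], and acyclicity passes it on to them. *)
Lemma unfold_exists D p r : {in verts T, forall v, degree T v = 1 \/ degree T v = 3} ->
  p \notin D -> r \in D -> adj T r p ->
  (forall x z, x \in branch D r -> z \notin D -> adj T x z -> x = r /\ z = p) ->
  exists t, [/\ troot t = r, uniq (tverts t), tverts t =i branch D r & unfolds p t].
Proof.
move=> degT; have [n] := ubnP #|D|; elim: n D p r => // n IH D p r leD pD rD rp bd.
have subD x : x \in D :\ r -> branch (D :\ r) x \subset D :\ r := @branch_sub _ x.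
have /andP[rT _] := adj_verts rp.
have leD' : #|D :\ r| < n by move: leD; rewrite (cardsD1 r) rD.
case: (degT r rT) => [d1|d3].
  have [w wP] := degree1_adj d1.
  have pw : p = w by apply/eqP; have := rp; rewrite wP inE.
  exists (Leaf r); split => //=; last by rewrite pw.
  move=> z; rewrite inE; apply/eqP/idP => [->|zB]; first exact: branch_self.
  apply: contraTeq isT => zr; have [x [rx + _]] := branch_step zB zr.
  move: rx; rewrite wP inE -pw => /eqP ->.
  by rewrite !inE (negPf pD) andbF.
have [x [y [Uxy xyP]]] := degree3_adj d3 rp.
move: Uxy; rewrite /= !inE negb_or !andbT => /andP[/andP[px py] xy].
have child w : w \in [:: x; y] -> exists t, [/\ troot t = w, uniq (tverts t),
    tverts t =i branch (D :\ r) w & unfolds r t] /\ [/\ w \in D :\ r & adj T r w].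
  move=> wxy; have rw : adj T r w by rewrite xyP inE wxy orbT.
  have wp : w != p by move: wxy; rewrite !inE => /orP[]/eqP ->; rewrite eq_sym.
  have wD : w \in D :\ r.
    rewrite !inE eq_sym (adj_neq rw) /=; apply: contraTT wp => wD.
    by have [_ ->] := bd r w (branch_self _ _) wD rw; rewrite eqxx.
  have [|||a z aB zD az|t tP] := IH (D :\ r) r w leD'; rewrite ?setD11 //.
  - by rewrite adj_sym.
  - have aD := subsetP (subD w wD) a aB.
    have za : z = r.
      apply: contraTeq isT => zr.
      have zD' : z \notin D by move: zD; rewrite !inE zr.
      have aB' : a \in branch D r.
        apply: branch_trans (subsetP (branch_mono w (subD1set D r)) a aB).
        apply: (branch_adj (branch_self _ _)) => //; by case/setD1P: wD.
      have [ar _] := bd a z aB' zD' az.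
      by rewrite ar setD11 in aD.
    split=> //; rewrite za adj_sym in az.
    by apply/esym; apply: (branch_neighbour_unique _ wD rw az aB); rewrite setD11.
  by exists t.
have [l [[rl Ul lB lU] [xD rx]]] := child x (mem_head _ _).
have [k [[rk Uk kB kU] [yD ry]]] := child y (mem_last x [:: y]).
exists (Node r l k); split => //=; last by rewrite rl rk; split.
  rewrite cat_uniq Ul Uk mem_cat lB kB negb_or /= andbT; apply/andP; split.
    by apply/andP; split; [move: (subD x xD) | move: (subD y yD)];
      apply: contraTN => rB; apply/subsetPn; exists r; rewrite ?setD11.
  (* A common vertex would place both children in one branch, against the uniqueness of the
     neighbour of [r] there. *)
  apply: contra xy => /hasP[z]; rewrite /= kB lB => zy zx; apply/eqP.
  apply: (branch_neighbour_unique _ xD rx ry); rewrite ?setD11 //.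
  by apply: branch_trans zx _; rewrite branch_sym.
move=> z; rewrite inE mem_cat lB kB; apply/idP/idP.
  have sub w : w \in D :\ r -> adj T r w -> z \in branch (D :\ r) w -> z \in branch D r.
    move=> /setD1P[_ wD] rw zw.
    apply: branch_trans (subsetP (branch_mono w (subD1set D r)) z zw).
    exact: (branch_adj (branch_self _ _)).
  case/or3P => [/eqP ->|zx|zy]; first exact: branch_self.
    exact: sub zx.
  exact: sub zy.
move=> zB; case: eqVneq => //= zr; have [w [rw wD zw]] := branch_step zB zr.
move: rw; rewrite xyP !inE => /or3P[]/eqP dw; rewrite dw in wD zw.
- by rewrite !inE (negPf pD) andbF in wD.
- by move: zw; rewrite !inE => ->.
- by move: zw; rewrite !inE => ->; rewrite orbT.
Qed.

Lemma unfolds_closed p t x y :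
  unfolds p t -> x \in tverts t -> adj T x y -> y \in p :: tverts t.
Proof.
elim: t p => [a|a l IHl k IHk] p /=.
  by move=> aP; rewrite inE => /eqP ->; rewrite aP !inE => ->.
case=> aP lU kU; rewrite !inE mem_cat => /or3P[/eqP ->|xl xy|xk xy].
- rewrite aP !inE mem_cat => /or3P[]/eqP ->; rewrite ?eqxx ?root_tverts ?orbT //.
- have := IHl a lU xl xy; rewrite inE mem_cat => /orP[]->; by rewrite ?orbT.
- have := IHk a kU xk xy; rewrite inE mem_cat => /orP[]->; by rewrite ?orbT.
Qed.

(** Prescribing the colour at [p] makes the colourings of the two branches agree at their common
    parent. *)
Lemma unfolds_bipartition p t (b : bool) : unfolds p t -> uniq (p :: tverts t) ->
  exists2 d : V -> bool, d p = b & {in tverts t, forall x y, adj T x y -> d x != d y}.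
Proof.
elim: t p b => [a|a l IHl k IHk] p b /=.
  rewrite inE andbT => aP pa; exists (fun z => if z == p then b else ~~ b).
    by rewrite eqxx.
  move=> x; rewrite inE => /eqP -> y; rewrite aP inE => /eqP ->.
  by rewrite eqxx [a == p]eq_sym (negPf pa); case: b.
case=> aP lU kU; rewrite inE !mem_cat cat_uniq !negb_or.
case/and4P=> /and3P[pa pl pk] /andP[al ak] Ul /andP[dlk Uk].
have [|dl dla dlP] := IHl a (~~ b) lU; first by rewrite /= al.
have [|dk dka dkP] := IHk a (~~ b) kU; first by rewrite /= ak.
pose d z := if z == p then b else if z == a then ~~ b else
  if z \in tverts l then dl z else dk z.
have da : d a = ~~ b by rewrite /d eqxx [a == p]eq_sym (negPf pa).
have dlE : {in tverts l, d =1 dl}.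
  move=> z zl; rewrite /d zl; case: eqVneq => [zp|_]; first by rewrite -zp zl in pl.
  by case: eqVneq => [za|//]; rewrite -za zl in al.
have dkE : {in tverts k, d =1 dk}.
  move=> z zk; rewrite /d; case: eqVneq => [zp|_]; first by rewrite -zp zk in pk.
  case: eqVneq => [za|_]; first by rewrite -za zk in ak.
  by case: ifP => // zl; case/hasP: dlk; exists z.
have dlE' : {in a :: tverts l, d =1 dl}.
  by move=> z; rewrite inE => /predU1P[->|/dlE //]; rewrite da.
have dkE' : {in a :: tverts k, d =1 dk}.
  by move=> z; rewrite inE => /predU1P[->|/dkE //]; rewrite da.
exists d; first by rewrite /d eqxx.
have inl x y : x \in tverts l -> adj T x y -> d x != d y.
  move=> xl xy; rewrite dlE // dlE' ?(unfolds_closed lU xl xy) //; exact: dlP.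
have ink x y : x \in tverts k -> adj T x y -> d x != d y.
  move=> xk xy; rewrite dkE // dkE' ?(unfolds_closed kU xk xy) //; exact: dkP.
move=> x; rewrite inE mem_cat => /or3P[/eqP ->|xl y|xk y]; [|exact: inl|exact: ink].
move=> y ay; have := ay; rewrite aP !inE => /or3P[]/eqP dy.
- by rewrite da dy /d eqxx; case: b {dla dlP dka dkP d da dlE dkE dlE' dkE' inl ink ay}.
- by rewrite eq_sym; apply: inl; rewrite 1?adj_sym // dy root_tverts.
- by rewrite eq_sym; apply: ink; rewrite 1?adj_sym // dy root_tverts.
Qed.

Lemma unfolds_alternating p t d : unfolds p t ->
  (forall x y, adj T x y -> d x != d y) -> alternating d t.
Proof.
move=> + dP; elim: t p => [//|a l IHl k IHk] p /= [aP lU kU].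
rewrite (IHl a) // (IHk a) // !andbT !(eq_sym _ (d a)).
by rewrite !dP // aP !inE eqxx ?orbT.
Qed.

Lemma unfolds_valid R p t c x : unfolds p t -> valid R c (c p) t -> x \in tverts t ->
  (forall y z, adj T x y -> adj T x z -> c y = c x -> c z = c x -> y = z) /\
  (R x -> x \notin inner t -> forall y, adj T x y -> c y != c x).
Proof.
elim: t p => [a|a l IHl k IHk] p /=.
  move=> aP va; rewrite inE => /eqP ->; split=> [y z|Ra _ y]; rewrite !aP !inE.
    by move=> /eqP -> /eqP ->.
  by move=> /eqP ->; rewrite eq_sym; apply: implyP Ra.
case=> aP lU kU /and3P[le1 vl vk]; rewrite !inE mem_cat negb_or.
have sub : x \notin inner l ++ inner k -> x \notin inner l /\ x \notin inner k.
  by rewrite mem_cat negb_or => /andP.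
case/or3P => [/eqP ->|xl|xk].
- rewrite eqxx /=; split=> // y z; rewrite !aP !inE.
  move=> /or3P[]/eqP -> /or3P[]/eqP -> // e1 e2; move: le1; rewrite e1 e2 !eqxx;
    by case: (_ == _).
- have [loc Rloc] := IHl a lU vl xl; split=> // Rx /andP[_ /sub[xi _]].
  exact: Rloc.
- have [loc Rloc] := IHk a kU vk xk; split=> // Rx /andP[_ /sub[_ xi]].
  exact: Rloc.
Qed.

Lemma unfolds_degree p t x : unfolds p t -> uniq (p :: tverts t) -> x \in tverts t ->
  degree T x = if x \in inner t then 3 else 1.
Proof.
elim: t p => [a|a l IHl k IHk] p /=.
  by move=> aP _; rewrite inE => /eqP ->; rewrite (degree_seq _ aP).
case=> aP lU kU; rewrite !inE !mem_cat cat_uniq !negb_or.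
case/and4P=> /and3P[pa pl pk] /andP[al ak] Ul /andP[dlk Uk].
case/or3P => [/eqP ->|xl|xk].
- rewrite eqxx /=; apply: (degree_seq (s := [:: p; troot l; troot k])) aP.
  rewrite /= !inE negb_or andbT; apply/andP; split; first apply/andP; first split.
  + by apply: contraNneq pl => ->; apply: root_tverts.
  + by apply: contraNneq pk => ->; apply: root_tverts.
  + apply: contra dlk => /eqP e; apply/hasP; exists (troot k); first exact: root_tverts.
    by rewrite /= -e root_tverts.
- rewrite (IHl a) //=; last by rewrite al.
  have -> : (x == a) = false by apply: contraNF al => /eqP <-.
  have -> // : (x \in inner k) = false; last by rewrite orbF.
  by apply: contraNF dlk => /inner_tverts xk; apply/hasP; exists x.
- rewrite (IHk a) //=; last by rewrite ak.
  have -> : (x == a) = false by apply: contraNF ak => /eqP <-.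
  have -> // : (x \in inner l) = false.
  by apply: contraNF dlk => /inner_tverts xl; apply/hasP; exists x.
Qed.

Lemma unfolds_weight p t c : unfolds p t -> uniq (p :: tverts t) ->
  weight c t = (\sum_(x <- tverts t) (degree T x)%:R * sgn (c x))%R.
Proof.
move=> tU Ut; have degE x := unfolds_degree tU Ut (x := x).
rewrite (eq_big_seq (fun x => (if x \in inner t then 3 else 1)%:R * sgn (c x))%R);
  last by move=> x xt; rewrite degE.
move: Ut => /= /andP[_]; elim: t {tU degE} => [a|a l IHl k IHk] /=.
  by move=> _; rewrite big_seq1 mul1r.
rewrite mem_cat cat_uniq negb_or => /and4P[/andP[al ak] Ul dlk Uk].
rewrite big_cons big_cat inE eqxx /= IHl // IHk // addrA.
congr (_ + _ + _)%R; apply: eq_big_seq => x xt; congr (_%:R * _)%R.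
  rewrite inE mem_cat; have -> : (x == a) = false by apply: contraNF al => /eqP <-.
  have -> // : (x \in inner k) = false; last by rewrite orbF.
  by apply: contraNF dlk => /inner_tverts xk; apply/hasP; exists x.
rewrite inE mem_cat; have -> : (x == a) = false by apply: contraNF ak => /eqP <-.
have -> // : (x \in inner l) = false.
by apply: contraNF dlk => /inner_tverts xl; apply/hasP; exists x.
Qed.

End TreeUnfolding.

(** * Planting a cubic tree at a leaf *)

Section CubicTrees.

Variables (V : finType) (T : graph V).
Hypothesis cubT : is_cubic_tree T.

Let acyT : acyclic T := cubT.1.2.

Lemma cubic_tree_branch p w : adj T p w ->
  exists t, [/\ troot t = w, uniq (p :: tverts t),
    tverts t =i branch T (verts T :\ p) w & unfolds T p t].
Proof.
move=> pw; have /andP[pT wT] := adj_verts pw.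
have wD : w \in verts T :\ p by rewrite !inE eq_sym (adj_neq pw).
have [||||t [rt Ut tB tU]] := unfold_exists acyT (D := verts T :\ p) (p := p) (r := w) cubT.2.
- by rewrite setD11.
- by [].
- by rewrite adj_sym.
- move=> x z xB; rewrite !inE negb_and negbK => zD xz.
  have /andP[_ zT] := adj_verts xz; rewrite zT orbF in zD.
  split; last exact/eqP.
  rewrite (eqP zD) adj_sym in xz; apply/esym.
  by apply: (branch_neighbour_unique acyT _ wD pw xz xB); rewrite setD11.
exists t; split => //=; rewrite Ut andbT tB.
by apply/negP => /(subsetP (branch_sub T wD)); rewrite setD11.
Qed.

Lemma unfolds_leaf p t : unfolds T p t -> exists2 x, x \in tverts t & degree T x = 1.
Proof.
elim: t p => [a|a l IHl k _] p /= => [aP|[_ /IHl[x xl d1] _]].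
  by exists a; [rewrite inE | apply: (degree_seq _ aP)].
by exists x => //; rewrite inE mem_cat xl orbT.
Qed.

(** The degree condition excludes a one-vertex tree, and the unfolding below any edge ends in
    leaves. *)
Lemma cubic_tree_leaf : exists2 u, u \in verts T & degree T u = 1.
Proof.
have [[[/set0Pn[v vT] _] _] degT] := cubT.
have [w vw] : exists w, adj T v w.
  have : 0 < #|[set x | adj T v x]| by rewrite -degree_adj; case: (degT v vT) => ->.
  by case/card_gt0P => w; rewrite inE; exists w.
have [t [_ _ tB /unfolds_leaf[x xt d1]]] := cubic_tree_branch vw.
exists x => //; apply: contraTT isT => /degree_notin; by rewrite d1.
Qed.

Lemma cubic_tree_unfold u : u \in verts T -> degree T u = 1 ->
  exists t, [/\ uniq (u :: tverts t), verts T =i u :: tverts t, unfolds T u t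
    & forall z, adj T u z = (z \in [:: troot t])].
Proof.
move=> uT /degree1_adj[w wP]; have uw : adj T u w by rewrite wP inE.
have [t [rt Ut tB tU]] := cubic_tree_branch uw.
exists t; split => //; last by rewrite rt.
move=> z; rewrite inE tB; case: eqVneq => [->|zu] //=.
have wD : w \in verts T :\ u.
  by have /andP[_ wT] := adj_verts uw; rewrite !inE eq_sym (adj_neq uw).
apply/idP/idP => [zT|/(subsetP (branch_sub T wD))]; last by case/setD1P.
(* By connectedness some path joins [u] to [z], and its first step must go to the only neighbour [w]
   of [u]. *)
have zB : z \in branch T (verts T) u.
  rewrite inE; apply: connect_sub (cubT.1.1.2 u z uT zT) => a b ab; apply: connect1.
  by rewrite /adj_in /= ab andbT (adj_verts ab).
have [x []] := branch_step zB zu.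
by rewrite wP inE => /eqP ->.
Qed.

Lemma cubic_tree_bipartition :
  exists d : V -> bool, forall x y, adj T x y -> d x != d y.
Proof.
have [u uT d1] := cubic_tree_leaf.
have [t [Ut tT tU uP]] := cubic_tree_unfold uT d1.
have [d _ dP] := unfolds_bipartition true tU Ut.
exists d => x y xy; have /andP[+ _] := adj_verts xy.
rewrite tT inE => /predU1P[dx|xt]; last exact: dP.
have := xy; rewrite dx uP inE => /eqP ->; rewrite eq_sym; apply: dP.
  exact: root_tverts.
by rewrite adj_sym uP inE.
Qed.

End CubicTrees.

(** * From colourings to balanced external splits *)

Section Splits.

Variables (V : finType) (G : graph V).
Hypothesis cubG : cubic G.

Implicit Types (c : V -> bool).

Lemma card_sgn c (D : {set V}) :
  (#|[set v in D | c v]|%:Z - #|[set v in D | ~~ c v]|%:Z = \sum_(v in D) sgn (c v))%R.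
Proof.
have sum_const (P : pred V) (x : int) : (\sum_(v in D | P v) x = x *+ #|[set v in D | P v]|)%R.
  rewrite (eq_bigl (mem [set v in D | P v])) => [|v]; last by rewrite !inE.
  by rewrite sumr_const.
rewrite (bigID c) /= (eq_bigr (fun=> 1%R)) => [|v /andP[_ ->] //].
rewrite [X in _ = (_ + X)%R](eq_bigr (fun=> (-1)%R)) => [|v /andP[_ /negPf ->] //].
by rewrite !sum_const mulNrn !natz.
Qed.

Lemma external_split_of_coloring c (z : int) :
  (forall v x y, adj G v x -> adj G v y -> c x = c v -> c y = c v -> x = y) ->
  (3 * (\sum_(v in verts G) sgn (c v)) = 2 * z)%R -> absz z <= 5 ->
  exists X Y : {set V},
    external_split G X Y /\ (- 2%:Z <= #|X|%:Z - #|Y|%:Z <= 2%:Z)%R.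
Proof.
move=> loc sumz z5.
exists [set v in verts G | c v], [set v in verts G | ~~ c v].
(* From [3 * s = 2 * z] and [|z| <= 5] it follows that [s] is even and [|s| <= 3], hence
   [|s| <= 2]. *)
split; last by rewrite card_sgn; move: (\sum_(v in _) _)%R sumz => s; lia.
split.
  split; last by apply/setP => v; rewrite !inE; case: (c v); rewrite ?andbT ?andbF ?orbF.
  rewrite -setI_eq0; apply/eqP/setP => v; rewrite !inE.
  by case: (c v); rewrite ?andbF.
move=> v vG; rewrite (cubG vG).
set H := del_edges _ _.
(* At a cubic vertex the bound 3/2 means degree at most 1. *)
have Hle : degree H v <= 1.
  have mono e : e \in edges H -> v \in e -> exists x, [/\ e = [set v; x], adj G v x & c x = c v].
    rewrite inE => /andP[nb eG] ve; have [x de vx] := edge_at eG ve.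
    exists x; split=> //; apply: contraNeq nb => cxv.
    have /andP[_ xG] := adj_verts vx.
    rewrite inE eG /=; case cv: (c v) cxv => cx.
      apply/exists_inP; exists v; rewrite ?inE ?vG //.
      by apply/exists_inP; exists x; rewrite ?inE ?xG ?de //; move: cx; case: (c x).
    apply/exists_inP; exists x; rewrite ?inE ?xG; first by move: cx; case: (c x).
    by apply/exists_inP; exists v; rewrite ?inE ?vG ?cv // de setUC.
  apply/card_le1_eqP => e e' /setIdP[eH ve] /setIdP[eH' ve'].
  have [x [-> vx cx]] := mono e eH ve; have [y [-> vy cy]] := mono e' eH' ve'.
  by rewrite (loc v x y).
apply: (@le_trans _ _ (1%:R)%R); first by rewrite ler_nat.
by rewrite mulrC ler_pdivlMr ?ltr0n // -natrM ler_nat.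
Qed.

Variable T : graph V.
Hypotheses (subT : subgraph T G) (cubT : is_cubic_tree T).

Let H := del_edges G (edges T).

(** Common end of both cases. Degrees in [T] and [H] add up to 3 on [G], so the signed edge ends of
    the planted tree and of [H] together give three times the difference of the colour classes. The
    condition on [H] also forbids a vertex to have monochromatic edges in both [T] and [H]. *)
Lemma external_split_of_tree_coloring R c u t (z : int) :
  uniq (u :: tverts t) -> verts T =i u :: tverts t -> unfolds T u t ->
  (forall x, adj T u x = (x \in [:: troot t])) -> valid R c (c u) t ->
  (forall x y y', adj H x y -> adj G x y' -> c y = c x -> c y' = c x -> y = y') ->
  (weight c t + sgn (c u) + \sum_(e in edges H) \sum_(v in e) sgn (c v) = 2 * z)%R ->
  absz z <= 5 ->
  exists X Y : {set V},
    external_split G X Y /\ (- 2%:Z <= #|X|%:Z - #|Y|%:Z <= 2%:Z)%R.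
Proof.
move=> Ut tT tU uP vt Hloc sumz z5.
apply: (external_split_of_coloring (c := c) _ _ z5) => [v x y|].
  rewrite [adj G v x](adjD _ _ subT) -/H => /orP[vx|vx]; last exact: Hloc.
  have [vy|nvy] := boolP (adj T v y); last first.
    rewrite (adjD _ _ subT) (negPf nvy) => vy cx cy; apply/esym.
    by apply: (Hloc v y x) => //; rewrite (adjD _ _ subT) vx.
  move=> _; have /andP[vT _] := adj_verts vx.
  move: vT; rewrite tT inE => /predU1P[dv|vt'].
    by move: vx vy; rewrite dv !uP !inE => /eqP -> /eqP ->.
  by apply: (unfolds_valid tU vt vt').1.
rewrite -sumz -handshake.
(* The summand [sgn (c u)] accounts for the leaf [u], which lies above [t] and has tree degree 1. *)
have -> : (weight c t + sgn (c u) = \sum_v (degree T v)%:R * sgn (c v))%R.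
  rewrite (bigID (mem (u :: tverts t))) /= [X in _ = (_ + X)%R]big1 => [|v vt']; last first.
    by rewrite degree_notin ?mul0r // tT.
  rewrite addr0 -(big_uniq _ Ut) big_cons (unfolds_weight c tU Ut) addrC.
  by rewrite (degree_seq _ uP) // mul1r.
rewrite -big_split /= [RHS](eq_bigr (fun v => (degree G v)%:R * sgn (c v))%R) => [|v _]; last first.
  by rewrite (degreeD v subT) natrD mulrDl.
rewrite [RHS](bigID (mem (verts G))) /= [X in _ = (_ + X)%R]big1 => [|v vG]; last first.
  by rewrite degree_notin // mul0r.
by rewrite addr0 mulr_sumr; apply: eq_bigr => v vG; rewrite cubG.
Qed.

Lemma sum_edge (f : V -> int) x y : x != y ->
  (\sum_(v in [set x; y]) f v = f x + f y)%R.
Proof. by move=> xy; rewrite big_setU1 ?inE // big_set1. Qed.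

Lemma sgn_neq b b' : b != b' -> (sgn b + sgn b' = 0)%R.
Proof. by case: b b' => [] []. Qed.

(** An inner vertex spends all three of its edges in [T]. *)
Lemma complement_not_inner u t x y : uniq (u :: tverts t) -> unfolds T u t ->
  adj H x y -> x \notin inner t.
Proof.
move=> Ut tU xy; have /andP[xG _] := adj_verts xy.
apply/negP => xi; have := cubG xG; rewrite (degreeD x subT) -/H.
rewrite (unfolds_degree tU Ut (inner_tverts xi)) xi degree_adj => /eqP.
rewrite -{2}[3]addn0 eqn_add2l cards_eq0 => /eqP/setP/(_ y).
by rewrite !inE xy.
Qed.

Lemma external_split_bipartite_complement (lam : V -> bool) :
  (forall x y, adj H x y -> lam x != lam y) ->
  exists X Y : {set V},
    external_split G X Y /\ (- 2%:Z <= #|X|%:Z - #|Y|%:Z <= 2%:Z)%R.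
Proof.
move=> lamP; have [u uT d1] := cubic_tree_leaf cubT.
have [t [Ut tT tU uP]] := cubic_tree_unfold cubT uT d1.
have /andP[ut Ut'] := Ut.
have [//|A AQ rA] := @realizable_tables _ pred0 lam t Ut'.
have [m [z [zA z5]]] := tables_final (lam u) AQ; move=> {AQ}.
have [c [cE _ vc wc]] := rA _ _ _ zA.
(* The colour that the table assumes above the root is the one prescribed at [u]. *)
have bu : (lam u == m) == m = lam u by case: (lam u) (m) => [] [].
have cu : c u = lam u by apply: cE; apply: contra ut; apply: inner_tverts.
rewrite bu -cu in vc wc.
have Hneq x y : adj H x y -> c x != c y.
  move=> xy; have yx : adj H y x by rewrite adj_sym.
  rewrite (cE x (complement_not_inner Ut tU xy)) (cE y (complement_not_inner Ut tU yx)).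
  exact: lamP.
apply: (external_split_of_tree_coloring Ut tT tU uP vc _ _ z5).
  by move=> x y y' xy _ cyx; have := Hneq _ _ xy; rewrite cyx eqxx.
rewrite big1 ?addr0 // => e eH.
have /andP[_ /cards2P[x [y [xy de]]]] := forall_inP (edges_wf H) _ eH.
by rewrite de sum_edge // sgn_neq // Hneq // /adj -de.
Qed.

(** The tree edges at [u] and [v] must be bichromatic, as [uv] already is monochromatic: at [v] this
    is enforced by the set [pred1 v], at [u] by giving the root of [t] the colour [false]. *)
Lemma external_split_one_mono_edge (lam d : V -> bool) u v :
  adj H u v -> lam u -> lam v ->
  (forall x y, adj H x y -> lam x = lam y -> [set x; y] = [set u; v]) ->
  (forall x y, adj T x y -> d x != d y) -> d u = d v ->
  degree T u = 1 -> degree T v = 1 ->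
  exists X Y : {set V},
    external_split G X Y /\ (- 2%:Z <= #|X|%:Z - #|Y|%:Z <= 2%:Z)%R.
Proof.
move=> uv lu lv lamP dP duv d1u d1v.
have inT x : degree T x = 1 -> x \in verts T.
  by move=> d1; apply: contraTT isT => /degree_notin; rewrite d1.
have [t [Ut tT tU uP]] := cubic_tree_unfold cubT (inT u d1u) d1u.
have /andP[ut Ut'] := Ut.
have vt : v \in tverts t.
  by have := inT v d1v; rewrite tT inE eq_sym (negPf (adj_neq uv)).
have vi : v \notin inner t.
  by apply: contra_eqN d1v => vi; rewrite (unfolds_degree tU Ut vt) vi.
have [A] := realizable_marked_tables lv Ut' vt vi (unfolds_alternating tU dP).
have -> : d v != d (troot t) by rewrite -duv dP // uP inE.
move=> AQ rA; have [z zA z5] := marked_tables_final AQ; move=> {AQ}.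
have [c [cE crt vc wc]] := rA _ _ _ zA.
have cu : c u by rewrite cE //; apply: contra ut; apply: inner_tverts.
have cv : c v by rewrite cE.
have Hmono x y : adj H x y -> c x = c y -> [set x; y] = [set u; v].
  move=> xy; have yx : adj H y x by rewrite adj_sym.
  rewrite (cE x (complement_not_inner Ut tU xy)) (cE y (complement_not_inner Ut tU yx)).
  exact: lamP.
have vc' : valid (pred1 v) c (c u) t by rewrite cu.
apply: (external_split_of_tree_coloring Ut tT tU uP vc' _ _ z5).
  (* A second monochromatic edge at [x] in [H] is again [uv]; one in [T] would be at [u] or [v],
     where it is excluded. *)
  move=> x y y' xy + cyx cyx'; rewrite (adjD _ _ subT) -/H => /orP[xy'|xy']; last first.
    apply: (@set2_inj _ x); rewrite Hmono // [RHS]Hmono //.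
  have exy := Hmono _ _ xy (esym cyx).
  have : x \in [set u; v] by rewrite -exy !inE eqxx.
  rewrite !inE => /orP[]/eqP dx; rewrite dx in xy' cyx'.
    by move: cyx'; rewrite cu; move: xy'; rewrite uP inE => /eqP ->; rewrite crt.
  have [_ /(_ (eqxx v) vi y' xy')] := unfolds_valid tU vc' vt.
  by rewrite cyx' eqxx.
(* The edge [uv] contributes 2, all other edges of [H] contribute 0. *)
rewrite (bigD1 [set u; v] uv) /= [X in (_ + (_ + X))%R]big1 ?addr0 => [|e /andP[eH euv]].
  rewrite sum_edge ?(adj_neq uv) // cu cv.
  by rewrite mulrDr -wc.
have /andP[_ /cards2P[x [y [xy de]]]] := forall_inP (edges_wf H) _ eH.
rewrite de sum_edge // sgn_neq //; apply: contra euv => /eqP cxy.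
by rewrite de Hmono // /adj -de.
Qed.

End Splits.

(** * Cycles and the tree-plus-cycle case *)

Section Cycles.

Variables (V : finType) (C : graph V).

Lemma index_next (s : seq V) x : uniq s -> x \in s ->
  index (next s x) s = if (index x s).+1 == size s then 0 else (index x s).+1.
Proof.
case: s => [//|y s] Us xs; rewrite next_nth xs.
have : index x (y :: s) < size (y :: s) by rewrite index_mem.
move: (index x _) => i; rewrite [size _]/= ltnS leq_eqVlt eqSS.
case: eqVneq => [-> _|_ lt_i]; first by rewrite nth_default //= eqxx.
by rewrite -[nth y s i]/(nth y (y :: s) i.+1) index_uniq.
Qed.

(** Otherwise two steps forward from the predecessor's position would return to it, which needs
    length at most 2. *)
Lemma next_neq_prev (s : seq V) x : 2 < size s -> uniq s -> x \in s ->
  next s x != prev s x.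
Proof.
move=> s3 Us xs; apply/eqP => /(congr1 (next s)); rewrite (next_prev Us).
move=> /(congr1 (index^~ s)); rewrite !index_next ?mem_next //.
move: s3; case: ((index x s).+1 =P size s) => [<-|_] s3; case: eqP => //; lia.
Qed.

Lemma cycle_edge s x y : edges C = [set [set x; next s x] | x in s] -> adj C x y ->
  (x \in s) && (y == next s x) || (y \in s) && (x == next s y).
Proof.
move=> eC; rewrite /adj eC => /imsetP[a ax e].
have : x \in [set a; next s a] by rewrite -e !inE eqxx.
rewrite !inE => /orP[/eqP dx|/eqP dx].
  by rewrite dx in e *; rewrite ax (set2_inj e) eqxx.
rewrite [RHS]setUC -dx in e.
by rewrite (set2_inj e) ax dx eqxx orbT.
Qed.

Lemma cycle_degree v : is_cycle C -> v \in verts C -> degree C v = 2.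
Proof.
case=> s [s3 Us vC eC]; rewrite vC inE => vs.
apply: (@degree_seq _ _ _ [:: next s v; prev s v]).
  by rewrite /= inE next_neq_prev.
move=> x; rewrite !inE; apply/idP/orP => [/(cycle_edge eC)|[]/eqP ->].
- case/orP => /andP[xs /eqP ->]; [by left | by right; rewrite prev_next].
- by rewrite /adj eC; apply: imset_f.
- rewrite /adj eC setUC; apply/imsetP; exists (prev s v); rewrite ?mem_prev //.
  by rewrite next_prev.
Qed.

Lemma path_parity (d : V -> bool) x s :
  path (fun a b => d a != d b) x s -> d (last x s) = d x (+) odd (size s).
Proof.
elim: s x => [|y s IH] x /=; first by rewrite addbF.
by case/andP => xy /IH ->; case: (d x) (d y) xy (odd _) => [] [] // _ [].
Qed.

(** Otherwise a full turn would change the colour an odd number of times and yet return to the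
    start. *)
Lemma odd_cycle_mono (d : V -> bool) s : uniq s -> odd (size s) ->
  exists2 x, x \in s & d x = d (next s x).
Proof.
move=> Us os; have [/hasP[x xs /eqP e]|/hasPn nh] :=
  boolP (has (fun x => d x == d (next s x)) s); first by exists x.
have := @cycle_from_next _ (fun a b => d a != d b) s Us nh.
case: s os {Us nh} => //= x s os /path_parity; rewrite last_rcons size_rcons /=.
by move: os => /=; case: (odd (size s)); case: (d x).
Qed.

End Cycles.

Lemma external_split_tree_cycle (V : finType) (G : graph V) :
  cubic G -> tree_cycle_decomposable G ->
  exists X Y : {set V},
    external_split G X Y /\ (- 2%:Z <= #|X|%:Z - #|Y|%:Z <= 2%:Z)%R.
Proof.
move=> cubG [T [C [[treeT cycC subT subC] [_ _ dTC eTC]]]].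
pose H := del_edges G (edges T).
have eH : edges H = edges C.
  apply/setP => e; rewrite !inE -eTC inE.
  by have := disjointFr dTC (x := e); case: (e \in edges T) => //= ->.
have adjH x y : adj H x y = adj C x y by rewrite /adj eH.
have degH v : degree H v = degree C v by rewrite /degree eH.
have degT v : v \in verts G -> degree T v = if v \in verts C then 1 else 3.
  move=> vG; have := cubG v vG; rewrite (degreeD v subT) -/H degH.
  case: ifP => vC; first by rewrite (cycle_degree cycC vC) => /eqP; rewrite (eqn_add2r 2 _ 1) => /eqP.
  by rewrite (degree_notin (negbT vC)) addn0.
have cubT : is_cubic_tree T.
  split=> // v /(subsetP subT.1)/degT ->; by case: ifP; [left | right].
have [s [s3 Us vC eC]] := cycC.
have [os|es] := boolP (odd (size s)); last first.
  apply: (external_split_bipartite_complement cubG subT cubT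
    (lam := fun x => odd (index x s))) => x y; rewrite -/H adjH => xy.
  (* At the wrap-around the last index is odd because the length is even. *)
  have step a : a \in s -> odd (index a s) != odd (index (next s a) s).
    move=> sa; rewrite index_next //; case: (_.+1 =P _) => /= [ea|_]; last by case: (odd _).
    by move: es; rewrite -ea /= negbK => ->.
  have /orP[/andP[xs /eqP ->]|/andP[ys /eqP ->]] := cycle_edge eC xy; first exact: step.
  by rewrite eq_sym step.
have [d dP] := cubic_tree_bipartition cubT.
have [u us du] := odd_cycle_mono d Us os.
have [i r dr] := rot_to us.
have Ur : uniq (u :: r) by rewrite -dr rot_uniq.
have szr : size (u :: r) = size s by rewrite -dr size_rot.
have idx a : a \in s -> index (next s a) (u :: r)
    = if (index a (u :: r)).+1 == size s then 0 else (index a (u :: r)).+1.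
  by move=> sa; rewrite -(next_rot i Us) dr index_next ?szr // -dr mem_rot.
(* Counted from [u], positions 0 and 1 are both [true] and the colours alternate from there on. The
   last position is even and positive, hence [false], so the wrap-around edge is bichromatic and
   only the edge from [u] to its successor is monochromatic. *)
pose lam x := (index x (u :: r) == 0) || odd (index x (u :: r)).
have iu : index u (u :: r) = 0 by rewrite /= eqxx.
have step a : a \in s -> lam a = lam (next s a) -> a = u.
  move=> sa; apply: contra_eq => au.
  have ia : index a (u :: r) = (index a r).+1 by rewrite /= eq_sym (negPf au).
  rewrite /lam idx // ia.
  by case: (_.+2 =P _) => /= [ea|_]; [move: os; rewrite -ea /= negbK => -> | case: (odd _)].
have uv : adj C u (next s u) by rewrite /adj eC; apply: imset_f.
have /andP[uC vC'] := adj_verts uv.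
have deg1 x : x \in verts C -> degree T x = 1.
  by move=> xC; rewrite degT ?xC // (subsetP subC.1).
apply: (external_split_one_mono_edge cubG subT cubT (lam := lam) _ _ _ _ dP du);
  rewrite ?deg1 // -/H ?adjH //.
- by rewrite /lam iu.
- by rewrite /lam idx // iu; case: (1 =P _) => // e; rewrite -e in s3.
- move=> x y; rewrite adjH => /(cycle_edge eC)/orP[]/andP[xs /eqP ->] e.
    by rewrite (step x xs e).
  by rewrite (step y xs (esym e)) setUC.
Qed.

Theorem theorem1p2 (V : finType) (G : graph V) (hG : cubic G)
  (h : (exists T : graph V,
          [/\ subgraph T G, is_cubic_tree T &
              bipartite (del_edges G (edges T))])
       \/ tree_cycle_decomposable G) :
  exists X Y : {set V},
    external_split G X Y /\ (- 2%:Z <= #|X|%:Z - #|Y|%:Z <= 2%:Z)%R.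
Proof.
case: h => [[T [subT cubT [X [Y [[dXY _] /subsetP eXY]]]]]|];
  last exact: external_split_tree_cycle.
apply: (external_split_bipartite_complement hG subT cubT
  (lam := fun x => x \in X)) => x y xy.
have := eXY _ xy; rewrite inE => /andP[_ /exists_inP[a aX /exists_inP[b bY /eqP e]]].
have aY := disjointFr dXY aX; have bX := disjointFl dXY bY.
have : x \in [set a; b] by rewrite -e !inE eqxx.
rewrite !inE => /orP[]/eqP dx; rewrite dx in e *.
  by rewrite (set2_inj e) aX bX.
by rewrite [RHS]setUC in e; rewrite (set2_inj e) aX bX.
Qed.
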